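(* Let $c>0$, and let $\alpha_l\in\mathcal{K}_l$, $\alpha_{cave}\in\mathcal{K}_{cave}$, $\alpha_{vex}\in\mathcal{K}_{vex}$ (all with domain containing $[0,c]$) satisfy $\alpha_l(c)=\alpha_{cave}(c)=\alpha_{vex}(c)$. Then for any $\epsilon\in(0,c)$, $$\sigma_{\alpha_{vex}}(\epsilon,c)\;<\;\sigma_{\alpha_l}(\epsilon,c)\;=\;\frac{\alpha_l(c)}{c}\;<\;\sigma_{\alpha_{cave}}(\epsilon,c).$$
   Context: A function $\alpha:[0,a)\to[0,\infty)$ (with $0<a\le\infty$) is of class $\mathcal{K}$ if it is continuous, strictly increasing on $[0,a)$ and $\alpha(0)=0$. $\mathcal{K}_l$, $\mathcal{K}_{cave}$, $\mathcal{K}_{vex}$ denote the class-$\mathcal{K}$ functions that are, respectively, linear ($\alpha(y)=\sigma y$ with $\sigma>0$), strictly concave, strictly convex. For $\alpha\in\mathcal{K}$ and $0<\epsilon<c$ (with $c$ in the domain of $\alpha$), the crossing time is $T_\alpha(\epsilon,c)=\int_\epsilon^c \frac{1}{\alpha(y)}\,dy$ (the time the solution of $\dot y=-\alpha(y)$, $y(0)=c$, needs to reach $\epsilon$), and the windowed nominal rate is $\sigma_\alpha(\epsilon,c)=\frac{\ln(c/\epsilon)}{T_\alpha(\epsilon,c)}$. *)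

(* Defs.v *)
From Stdlib Require Import Reals.
From Coquelicot Require Import Coquelicot.
Open Scope R_scope.

(* The interval [0, a), where a may be p_infty. A function on [0, a) is
   encoded as a total function R -> R whose values outside [0, a) are
   never constrained. *)
Definition dom (a : Rbar) (y : R) : Prop := 0 <= y /\ Rbar_lt y a.

(* [continuous_on] is relative to [dom a], hence one-sided at 0. *)
Definition classK (a : Rbar) (alpha : R -> R) : Prop :=
  Rbar_lt 0 a /\
  (forall y, dom a y -> 0 <= alpha y) /\
  continuous_on (dom a) alpha /\
  (forall x y, dom a x -> dom a y -> x < y -> alpha x < alpha y) /\
  alpha 0 = 0.

Definition strictly_convex_on (D : R -> Prop) (f : R -> R) : Prop :=
  forall x y t, D x -> D y -> x <> y -> 0 < t < 1 ->
    f (t * x + (1 - t) * y) < t * f x + (1 - t) * f y.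

Definition strictly_concave_on (D : R -> Prop) (f : R -> R) : Prop :=
  forall x y t, D x -> D y -> x <> y -> 0 < t < 1 ->
    t * f x + (1 - t) * f y < f (t * x + (1 - t) * y).

Definition classK_l (a : Rbar) (alpha : R -> R) : Prop :=
  classK a alpha /\
  exists sigma : R, 0 < sigma /\ forall y, dom a y -> alpha y = sigma * y.

Definition classK_cave (a : Rbar) (alpha : R -> R) : Prop :=
  classK a alpha /\ strictly_concave_on (dom a) alpha.

Definition classK_vex (a : Rbar) (alpha : R -> R) : Prop :=
  classK a alpha /\ strictly_convex_on (dom a) alpha.

(* For alpha of class K on [0, a) and 0 < eps < c < a the integrand is
   continuous on [eps, c], so this is a genuine Riemann integral. *)
Definition crossing_time (alpha : R -> R) (eps c : R) : R :=
  RInt (fun y => 1 / alpha y) eps c.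

Definition nominal_rate (alpha : R -> R) (eps c : R) : R :=
  ln (c / eps) / crossing_time alpha eps c.

(* Main.v *)
Require Import Defs.
From Stdlib Require Import Reals Lra.
From Coquelicot Require Import Coquelicot.
Open Scope R_scope.

(** The linear function [alpha_l y = sigma * y] is the chord of each of the
    other two functions on [0, c], since all three vanish at 0 and agree at [c].
    Strict convexity puts [alpha_vex] strictly below this chord inside (0, c),
    and strict concavity puts [alpha_cave] strictly above it
    ([strictly_convex_below_chord], [strictly_concave_above_chord]). A function
    that is larger inside the window decays faster: its reciprocal has a smaller
    integral, so its windowed nominal rate is larger ([nominal_rate_lt]). It only
    remains to see that the rate of [sigma * y] is [sigma] on every window
    ([nominal_rate_linear]), because the crossing time of an exponential decay is
    [ln (c / eps) / sigma]. *)

Lemma dom_between (a : Rbar) (c y : R) : dom a c -> 0 <= y <= c -> dom a y.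
Proof.
intros [_ hca] [h0 hyc]; split; [exact h0|].
exact (Rbar_le_lt_trans y c a hyc hca).
Qed.

(** Every positive point of [0, a) is interior, so that the one-sidedness of
    continuity relative to [dom a] is felt only at 0. *)
Lemma classK_continuous (a : Rbar) (alpha : R -> R) (y : R) :
  classK a alpha -> dom a y -> 0 < y -> continuous alpha y.
Proof.
intros (_ & _ & hcont & _) [_ hya] hy.
apply (continuous_continuous_on (dom a)); [|exact hcont].
apply filter_and.
- apply filter_imp with (fun u => 0 < u); [intros u; apply Rlt_le|].
  exact (open_gt 0 y hy).
- exact (open_Rbar_lt a y hya).
Qed.

Lemma classK_pos (a : Rbar) (alpha : R -> R) (y : R) :
  classK a alpha -> dom a y -> 0 < y -> 0 < alpha y.
Proof.
intros (_ & _ & _ & hincr & h0) hya hy.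
rewrite <- h0; apply hincr; [|exact hya|exact hy].
apply dom_between with y; [exact hya|lra].
Qed.

Lemma strictly_convex_below_chord (D : R -> Prop) (f : R -> R) (c y : R) :
  strictly_convex_on D f -> D 0 -> D c -> f 0 = 0 -> 0 < y < c ->
  f y < f c / c * y.
Proof.
intros hconv hD0 hDc h0 hy.
assert (ht : 0 < y / c < 1).
{ split; [apply Rdiv_lt_0_compat; lra|].
  apply Rmult_lt_reg_r with c; [lra|].
  unfold Rdiv; rewrite Rmult_assoc, Rinv_l; lra. }
assert (h := hconv c 0 (y / c) hDc hD0 ltac:(lra) ht).
rewrite h0 in h.
replace (y / c * c + (1 - y / c) * 0) with y in h by (field; lra).
replace (f c / c * y) with (y / c * f c + (1 - y / c) * 0) by (field; lra).
exact h.
Qed.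

Lemma strictly_concave_above_chord (D : R -> Prop) (f : R -> R) (c y : R) :
  strictly_concave_on D f -> D 0 -> D c -> f 0 = 0 -> 0 < y < c ->
  f c / c * y < f y.
Proof.
intros hconc hD0 hDc h0 hy.
assert (hopp : strictly_convex_on D (fun x => - f x)).
{ intros u v t hu hv huv ht; generalize (hconc u v t hu hv huv ht); lra. }
assert (h := strictly_convex_below_chord D (fun x => - f x) c y hopp hD0 hDc).
specialize (h ltac:(lra) hy); simpl in h.
replace (- f c / c * y) with (- (f c / c * y)) in h by (field; lra).
lra.
Qed.

Lemma continuous_recip (f : R -> R) (y : R) :
  continuous f y -> 0 < f y -> continuous (fun x => 1 / f x) y.
Proof.
intros hf hpos.
apply continuous_ext with (fun x => / f x);
  [intros x; unfold Rdiv; rewrite Rmult_1_l; reflexivity|].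
apply continuous_Rinv_comp; [exact hf|lra].
Qed.

Lemma crossing_time_pos (f : R -> R) (eps c : R) :
  eps < c ->
  (forall y, eps <= y <= c -> continuous f y) ->
  (forall y, eps <= y <= c -> 0 < f y) ->
  0 < crossing_time f eps c.
Proof.
intros hlt hf hpos; apply RInt_gt_0; [exact hlt| |].
- intros y hy; apply Rdiv_lt_0_compat; [lra|apply hpos; lra].
- intros y hy; apply continuous_recip; auto.
Qed.

(** Only the inside of the window is compared, because functions that meet at
    the end [c] of the window are to be covered; continuity of the reciprocals
    still makes the inequality of the integrals strict. *)
Lemma nominal_rate_lt (f g : R -> R) (eps c : R) :
  0 < eps < c ->
  (forall y, eps <= y <= c -> continuous f y) ->
  (forall y, eps <= y <= c -> continuous g y) ->
  (forall y, eps <= y <= c -> 0 < f y) ->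
  (forall y, eps <= y <= c -> 0 < g y) ->
  (forall y, eps < y < c -> f y < g y) ->
  nominal_rate f eps c < nominal_rate g eps c.
Proof.
intros [h0 hlt] hf hg hfpos hgpos hfg.
assert (hln : 0 < ln (c / eps)).
{ rewrite ln_div by lra; generalize (ln_increasing eps c h0 hlt); lra. }
assert (htg := crossing_time_pos g eps c hlt hg hgpos).
assert (htime : crossing_time g eps c < crossing_time f eps c).
{ apply RInt_lt; [exact hlt| | |].
  - intros y hy; apply continuous_recip; auto.
  - intros y hy; apply continuous_recip; auto.
  - intros y hy; unfold Rdiv; apply Rmult_lt_compat_l; [lra|].
    apply Rinv_0_lt_contravar; [apply hfpos; lra|auto]. }
apply Rmult_lt_compat_l; [exact hln|].
now apply Rinv_0_lt_contravar.
Qed.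

Lemma nominal_rate_linear (f : R -> R) (sigma eps c : R) :
  0 < eps < c -> 0 < sigma ->
  (forall y, eps <= y <= c -> f y = sigma * y) ->
  nominal_rate f eps c = sigma.
Proof.
intros [h0 hlt] hsigma hf.
assert (hln : 0 < ln (c / eps)).
{ rewrite ln_div by lra; generalize (ln_increasing eps c h0 hlt); lra. }
assert (htime : crossing_time f eps c = ln (c / eps) / sigma).
{ unfold crossing_time.
  rewrite (RInt_ext _ (fun y => / (sigma * y)));
    rewrite ?Rmin_left, ?Rmax_right by lra.
  2:{ intros y hy; rewrite hf by lra; unfold Rdiv; apply Rmult_1_l. }
  apply is_RInt_unique.
  replace (ln (c / eps) / sigma) with (minus (ln c / sigma) (ln eps / sigma))
    by (rewrite ln_div by lra; unfold minus, plus, opp; simpl; field; lra).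
  apply (is_RInt_derive (fun y => ln y / sigma) (fun y => / (sigma * y)));
    rewrite ?Rmin_left, ?Rmax_right by lra; intros y hy.
  - auto_derive; [lra|field; lra].
  - apply continuous_Rinv_comp.
    + apply (ex_derive_continuous (fun y => sigma * y)); auto_derive; exact I.
    + apply Rgt_not_eq, Rmult_lt_0_compat; lra. }
unfold nominal_rate; rewrite htime; field; lra.
Qed.

Theorem proposition1 (c : R) (a_l a_cave a_vex : Rbar)
    (alpha_l alpha_cave alpha_vex : R -> R)
    (hc : 0 < c)
    (hl : classK_l a_l alpha_l)
    (hcave : classK_cave a_cave alpha_cave)
    (hvex : classK_vex a_vex alpha_vex)
    (hcl : dom a_l c) (hccave : dom a_cave c) (hcvex : dom a_vex c)
    (heq_cave : alpha_l c = alpha_cave c)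
    (heq_vex : alpha_cave c = alpha_vex c) :
  forall eps : R, 0 < eps < c ->
    nominal_rate alpha_vex eps c < nominal_rate alpha_l eps c /\
    nominal_rate alpha_l eps c = alpha_l c / c /\
    alpha_l c / c < nominal_rate alpha_cave eps c.
Proof.
intros eps heps.
destruct hl as [hKl [sigma [hsigma hlin]]].
destruct hcave as [hKcave hconc], hvex as [hKvex hconv].
assert (hwindow : forall a alpha, classK a alpha -> dom a c ->
  forall y, eps <= y <= c -> continuous alpha y /\ 0 < alpha y).
{ intros a alpha hK hca y hy.
  assert (hya : dom a y) by (apply dom_between with c; [exact hca|lra]).
  split; [apply classK_continuous with a|apply classK_pos with a]; auto; lra. }
assert (hdom0 : forall a, dom a c -> dom a 0)
  by (intros a hca; apply dom_between with c; [exact hca|lra]).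
assert (hslope : alpha_l c / c = sigma) by (rewrite hlin by auto; field; lra).
assert (hlin_window : forall y, eps <= y <= c -> alpha_l y = sigma * y)
  by (intros y hy; apply hlin, dom_between with c; [exact hcl|lra]).
assert (hrate : nominal_rate alpha_l eps c = alpha_l c / c)
  by (rewrite hslope; now apply nominal_rate_linear).
split; [|split]; [|exact hrate|rewrite <- hrate];
  apply nominal_rate_lt; auto;
  try (intros y hy; eapply hwindow; eassumption);
  intros y hy; rewrite hlin_window, <- hslope by lra.
- rewrite heq_cave, heq_vex.
  apply strictly_convex_below_chord with (dom a_vex); auto; [apply hKvex|lra].
- rewrite heq_cave.
  apply strictly_concave_above_chord with (dom a_cave); auto; [apply hKcave|lra].
Qed.
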